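(* Fix $c>0$ and $\kappa\in(0,1)$. The slow manifold $S_\epsilon=\{(\theta,h(\theta,\epsilon)):\theta\in[0,1-\kappa]\}$ of the system $$\dot\theta=\eta,\qquad \dot\eta=c\,\eta-\frac{1}{2\epsilon^2}\,\theta(1-\theta)\,e^{-\epsilon^{-1}(1-\theta)},\qquad 0<\epsilon\ll1,$$ has the following asymptotic expansion as $\epsilon\to0$: $$\eta=h(\theta,\epsilon)=\sum_{k=1}^\infty\frac{1}{2^k}F_k(\theta,\epsilon)\,\epsilon^{-3k+1}e^{-k\epsilon^{-1}(1-\theta)} =\frac{1}{2c}\theta(1-\theta)\,\epsilon^{-2}e^{-\epsilon^{-1}(1-\theta)}+\mathcal O\!\left(\epsilon^{-5}e^{-2\epsilon^{-1}(1-\theta)}\right),$$ with $F_1(\theta,\epsilon)=\frac1c\theta(1-\theta)$ and each $F_k$, $k\ge2$, smooth and satisfying the recursion $$cF_k=\sum_{j=1}^{k-1}\left(\epsilon\,\frac{\partial}{\partial\theta}F_j(\theta,\epsilon)+jF_j(\theta,\epsilon)\right)F_{k-j}(\theta,\epsilon),\qquad k\ge2.$$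
   Context: The overdot denotes $d/dz$. For $\theta\in[0,1)$ the limit $\epsilon\to0$ of the system is $\dot\theta=\eta$, $\dot\eta=c\eta$, which has the critical manifold $S=\{(\theta,0):\theta\in[0,1)\}$; it is normally hyperbolic and repelling, with nontrivial eigenvalue $c>0$. By Fenichel theory, for $\kappa\in(0,1)$ an arbitrarily small but fixed constant, there is for all sufficiently small $\epsilon>0$ a locally invariant slow manifold (a locally invariant curve that is $\mathcal O(\epsilon)$-close to $S$) of the form $S_\epsilon=\{(\theta,h(\theta,\epsilon)):\theta\in[0,1-\kappa]\}$, where for every $N\in\mathbb N$ the function $h$ is $C^N$-smooth for $\epsilon\in[0,\epsilon_0(N))$. As is usual for Fenichel slow manifolds, $S_\epsilon$ need not be unique, and ''the slow manifold'' refers to a (suitable) choice of such a manifold. The infinite sum is an asymptotic (not necessarily convergent) series: for every $K\ge1$, truncating after $K$ terms leaves an error $\mathcal O(\epsilon^{-3(K+1)+1}e^{-(K+1)\epsilon^{-1}(1-\theta)})$ on $\theta\in[0,1-\kappa]$ as $\epsilon\to0$. *)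

(* Defs.v *)
From Stdlib Require Import Reals ZArith.
From Coquelicot Require Import Coquelicot.

Open Scope R_scope.

(* [Cn N D f]: f is C^N on the set D of the plane, up to and including the part
   of the boundary that belongs to D: partial derivatives are limits of
   difference quotients taken inside D (one-sided at an edge of a rectangle),
   and f is C^N when it is continuous on D and, for N > 0, its two partial
   derivatives exist on D and are C^(N-1) on D.  The values of f and of the
   witnesses outside D are irrelevant. *)
Fixpoint Cn (N : nat) (D : R -> R -> Prop) (f : R -> R -> R) : Prop :=
  continuous_on (fun p : R * R => D (fst p) (snd p))
                (fun p : R * R => f (fst p) (snd p)) /\
  match N with
  | O => True
  | S m => exists f1 f2 : R -> R -> R,
      (forall x y : R, D x y ->
         D_in (fun t => f t y) (fun t => f1 t y) (fun t => D t y) x /\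
         D_in (fun t => f x t) (fun t => f2 x t) (fun t => D x t) y) /\
      Cn m D f1 /\ Cn m D f2
  end.

Definition smooth2 (f : R -> R -> R) : Prop :=
  forall N : nat, Cn N (fun _ _ => True) f.

Definition is_solution_at (c eps : R) (theta eta : R -> R) (z : R) : Prop :=
  is_derive theta z (eta z) /\
  is_derive eta z
    (c * eta z
     - / (2 * eps ^ 2) * (theta z * (1 - theta z))
       * exp (- (/ eps * (1 - theta z)))).

(* Local invariance of the graph of g over [0, 1 - kappa] under the flow:
   the trajectory through a point of the graph which is not an end point stays
   on the graph for short positive and negative times, so that trajectories can
   leave the graph only through its two end points.  (Solutions of the system
   are unique, so "a solution" here is "the solution".) *)
Definition locally_invariant (c kappa eps : R) (g : R -> R) : Prop :=
  forall theta0 : R, 0 < theta0 < 1 - kappa ->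
  exists (delta : R) (theta eta : R -> R),
    0 < delta /\ theta 0 = theta0 /\ eta 0 = g theta0 /\
    forall z : R, Rabs z < delta ->
      is_solution_at c eps theta eta z /\
      0 <= theta z <= 1 - kappa /\ eta z = g (theta z).

(* S_eps = {(theta, h theta eps) : 0 <= theta <= 1 - kappa}, a Fenichel slow
   manifold.  In the third clause eps = 0 is included: there h vanishes, which
   is the critical manifold S. *)
Definition slow_manifold (c kappa : R) (h : R -> R -> R) : Prop :=
  (forall N : nat, exists eps0 : R, 0 < eps0 /\
     Cn N (fun theta eps => 0 <= theta <= 1 - kappa /\ 0 <= eps < eps0) h) /\
  (exists eps0 : R, 0 < eps0 /\
     forall eps : R, 0 < eps < eps0 ->
       locally_invariant c kappa eps (fun theta => h theta eps)) /\
  (exists M eps0 : R, 0 < eps0 /\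
     forall theta eps : R, 0 <= theta <= 1 - kappa -> 0 <= eps < eps0 ->
       Rabs (h theta eps) <= M * eps).

(* Slow manifolds are not unique, and the expansion cannot hold for all of
   them: S is repelling, so the value of h at the exit point theta = 1 - kappa
   can be perturbed freely, for instance by exp (- kappa / (2 eps)), which is
   larger than every term of the expansion.  A suitable choice of S_eps is one
   that is part of a slow manifold over a larger interval [0, 1 - kappa'] with
   0 < kappa' < kappa; Fenichel theory, applied with kappa' in place of kappa,
   provides such a choice. *)
Definition suitable_slow_manifold (c kappa : R) (h : R -> R -> R) : Prop :=
  slow_manifold c kappa h /\
  exists (kappa' : R) (h' : R -> R -> R),
    0 < kappa' < kappa /\ slow_manifold c kappa' h' /\
    exists eps0 : R, 0 < eps0 /\
      forall theta eps : R, 0 <= theta <= 1 - kappa -> 0 < eps < eps0 ->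
        h' theta eps = h theta eps.

(* [f] is O([g]) as eps -> 0+, uniformly for theta in [0, 1 - kappa]. *)
Definition bigO_unif (kappa : R) (f g : R -> R -> R) : Prop :=
  exists M eps0 : R, 0 < eps0 /\
    forall theta eps : R, 0 <= theta <= 1 - kappa -> 0 < eps < eps0 ->
      Rabs (f theta eps) <= M * Rabs (g theta eps).

(* eps^(-3k+1) e^(-k (1-theta)/eps) *)
Definition gauge (k : nat) (theta eps : R) : R :=
  powerRZ eps (-3 * Z.of_nat k + 1)
  * exp (- (INR k * / eps * (1 - theta))).

Definition truncation (F : nat -> R -> R -> R) (K : nat) (theta eps : R) : R :=
  sum_n_m (fun k => / 2 ^ k * F k theta eps * gauge k theta eps) 1 K.

(* Main.v *)
Require Import Defs.
From Stdlib Require Import Reals ZArith.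
From Coquelicot Require Import Coquelicot.
From Stdlib Require Import Ranalysis5 Lra Lia.

Open Scope R_scope.

(** Invariance of the graph of [g] means [g g' = c g - f], [f] being the forcing.
    With [x = eps^-3 exp (- (1 - theta) / eps) / 2], for which [x' = x / eps], the
    truncated series is [T = eps * sum_(k <= K) F_k x^k]; the recursion for the
    [F_k] says exactly that [T T' = c T - f + R] with [R = O(eps x^(K+1))], so that
    [w = g - T] satisfies [g w' = (c - T') w - R].
    As the equation is repelling, a solution that is too large somewhere blows up
    before the right end of a slightly larger interval, where it is known to be
    O(eps).  This is used three times on [0, 1 - kappa']: it gives [g > 0], then
    [g <= A eps] with [A] as small as we like, and finally [|w| <= B eps x^(K+1)],
    because [w] would otherwise grow at the rate [c / (4 g)], which beats the factor
    exp (- (K + 1) / eps) contained in [x^(K+1)]. *)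

(** * Escape along a repelling direction *)

(** By continuity, the supremum [s] of the points where [phi] is at least [phi a] is itself such a
    point. There [phi s > B], so [phi] stays above [B], and hence does not decrease, a little beyond
    [s]; this forces [s = b]. *)
Lemma ge_start_of_nondecreasing_above (phi dphi : R -> R) (a b B : R) :
  a <= b ->
  (forall x, a <= x <= b -> is_derive phi x (dphi x)) ->
  (forall x, a <= x <= b -> B <= phi x -> 0 <= dphi x) ->
  B < phi a -> phi a <= phi b.
Proof.
intros hab hd hpos hB.
assert (hcont : forall x, a <= x <= b -> continuity_pt phi x).
{ intros x hx; apply derivable_continuous_pt; exists (dphi x).
  apply is_derive_Reals, hd, hx. }
set (S := fun x => a <= x <= b /\ phi a <= phi x).
destruct (completeness S) as [s [hub hlub]].
- exists b; intros x [hx _]; lra.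
- exists a; split; lra.
- assert (has : a <= s) by (apply hub; split; lra).
  assert (hsb : s <= b) by (apply hlub; intros x [hx _]; lra).
  assert (hs : phi a <= phi s).
  { destruct (Rle_or_lt (phi a) (phi s)) as [h | h]; [exact h | exfalso].
    destruct (hcont s (conj has hsb) (phi a - phi s)) as [d [hd0 hnear]]; [lra |].
    (* If [phi s < phi a], no point within [d] of [s] lies in [S], so [s - d] would be a smaller
       upper bound. *)
    assert (s <= s - d); [| lra].
    apply hlub; intros x [hx hax].
    destruct (Rle_or_lt x (s - d)) as [hle | hgt]; [exact hle | exfalso].
    assert (hxs : x <= s) by (apply hub; split; assumption).
    destruct (Req_dec x s) as [-> | hne]; [lra |].
    specialize (hnear x); simpl in hnear; unfold Rdist in hnear.
    assert (hlt : Rabs (phi x - phi s) < phi a - phi s).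
    { apply hnear; split; [split; [exact I | auto] |].
      apply Rabs_def1; lra. }
    apply Rabs_def2 in hlt; lra. }
  destruct (Req_dec s b) as [<- | hne]; [exact hs | exfalso].
  destruct (hcont s (conj has hsb) (phi s - B)) as [d [hd0 hnear]]; [lra |].
  set (x := Rmin b (s + d / 2)).
  assert (hx : s < x <= b /\ x <= s + d / 2)
    by (unfold x, Rmin; destruct (Rle_dec b (s + d / 2)); lra).
  assert (hge : phi s <= phi x).
  { destruct (MVT_gen phi s x dphi) as [y [hy heq]];
      rewrite ?Rmin_left, ?Rmax_right in * by lra.
    - intros y hy; apply hd; lra.
    - intros y hy; apply hcont; lra.
    - assert (0 <= dphi y); [| nra].
      apply hpos; [lra |].
      destruct (Req_dec y s) as [-> | hys]; [lra |].
      specialize (hnear y); simpl in hnear; unfold Rdist in hnear.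
      assert (hlt : Rabs (phi y - phi s) < phi s - B).
      { apply hnear; split; [split; [exact I | auto] |].
        apply Rabs_def1; lra. }
      apply Rabs_def2 in hlt; lra. }
  assert (x <= s) by (apply hub; split; lra).
  lra.
Qed.

(* If [w] started above [B * gam], then [w * exp (- mu * (x - a))] would be
   nondecreasing as long as it exceeds [B * gam a]: there the linear term of
   the equation dominates [r], and [c / (4 * g) >= mu]. *)
Lemma repelling_linear_bound (c mu nu B C a b gam0 : R) (g w dw q r : R -> R) :
  0 < c -> a <= b -> 0 <= nu <= mu -> 0 < mu -> 0 < gam0 -> 0 < B -> 4 * C <= c * B ->
  (forall x, a <= x <= b -> is_derive w x (dw x)) ->
  (forall x, a <= x <= b -> 0 < g x /\ 4 * mu * g x <= c) ->
  (forall x, a <= x <= b -> g x * dw x = (c - q x) * w x - r x) ->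
  (forall x, a <= x <= b -> q x <= c / 2) ->
  (forall x, a <= x <= b -> r x <= C * (gam0 * exp (nu * (x - a)))) ->
  w b <= B * gam0 * exp (mu * (b - a)) ->
  w a <= B * gam0.
Proof.
intros hc hab hnu hmu hgam hB hBC hder hg heq hq hr hend.
destruct (Rle_or_lt (w a) (B * gam0)) as [h | h]; [exact h | exfalso].
set (phi := fun x => w x * exp (- (mu * (x - a)))).
set (dphi := fun x => (dw x - mu * w x) * exp (- (mu * (x - a)))).
assert (hBg : 0 < B * gam0) by nra.
assert (h1 : phi a <= phi b).
{ apply (ge_start_of_nondecreasing_above phi dphi a b (B * gam0) hab).
  - intros x hx; unfold phi, dphi.
    assert (hw := hder x hx).
    auto_derive; [repeat split; exists (dw x); exact hw |].
    change (Derive (fun t => w t) x) with (Derive w x).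
    rewrite (is_derive_unique _ _ _ hw); unfold Rminus; ring.
  - intros x hx hphi; unfold phi in hphi; unfold dphi.
    apply Rmult_le_pos; [| left; apply exp_pos].
    assert (hxa : 0 <= x - a) by lra.
    assert (hwx : B * gam0 * exp (mu * (x - a)) <= w x).
    { apply Rmult_le_reg_r with (exp (- (mu * (x - a)))); [apply exp_pos |].
      rewrite Rmult_assoc, <- exp_plus, Rplus_opp_r, exp_0; lra. }
    assert (hexp : exp (nu * (x - a)) <= exp (mu * (x - a))).
    { destruct (Req_dec (nu * (x - a)) (mu * (x - a))) as [e | e];
        [rewrite e; lra |].
      left; apply exp_increasing.
      assert (nu * (x - a) <= mu * (x - a)) by (apply Rmult_le_compat_r; lra).
      lra. }
    assert (hp := exp_pos (nu * (x - a))).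
    assert (hlow : B * (gam0 * exp (nu * (x - a))) <= w x).
    { apply Rle_trans with (2 := hwx); rewrite Rmult_assoc.
      apply Rmult_le_compat_l; [lra |].
      apply Rmult_le_compat_l; lra. }
    specialize (hg x hx); specialize (heq x hx); specialize (hq x hx);
      specialize (hr x hx).
    set (G := gam0 * exp (nu * (x - a))) in *.
    assert (hG : 0 < G) by (apply Rmult_lt_0_compat; assumption).
    assert (hw0 : 0 < w x) by nra.
    assert (hrw : r x <= c / 4 * w x).
    { assert (C * G <= c / 4 * (B * G)); [nra |].
      assert (c / 4 * (B * G) <= c / 4 * w x) by (apply Rmult_le_compat_l; lra).
      lra. }
    (* The right side is [(c - q x) * w x - r x], at least [(c / 2 - c / 4) * w x], and
       [c / 4 >= mu * g x]. *)
    assert (hgd : mu * w x * g x <= g x * dw x) by nra.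
    assert (mu * w x <= dw x); [| lra].
    apply Rmult_le_reg_l with (g x); lra.
  - unfold phi.
    replace (- (mu * (a - a))) with 0 by ring; rewrite exp_0; lra. }
assert (h2 : phi b <= B * gam0).
{ unfold phi; apply Rmult_le_reg_r with (exp (mu * (b - a))); [apply exp_pos |].
  rewrite Rmult_assoc, <- exp_plus, Rplus_opp_l, exp_0; lra. }
unfold phi in h1 at 1; replace (- (mu * (a - a))) with 0 in h1 by ring.
rewrite exp_0 in h1; lra.
Qed.

(** * The slow manifold as a solution curve *)

Definition forcing (eps theta : R) : R :=
  / (2 * eps ^ 2) * (theta * (1 - theta)) * exp (- (/ eps * (1 - theta))).

(** The C^1 clause gives derivatives relative to [[0, 1 - kappa]], which are ordinary derivatives at
    interior points. At 0 the one-sided derivative yields a right limit, enough to carry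
    inequalities over to this end point. *)
Lemma slow_manifold_derivable (c kappa : R) (h : R -> R -> R) :
  0 < kappa < 1 -> slow_manifold c kappa h ->
  exists eps0 : R, 0 < eps0 /\ forall eps : R, 0 < eps < eps0 ->
    limit1_in (fun t => h t eps) (fun t => 0 < t < 1 - kappa) (h 0 eps) 0 /\
    exists dh : R -> R,
      forall theta, 0 < theta < 1 - kappa ->
        is_derive (fun t => h t eps) theta (dh theta).
Proof.
intros hk [hsm _].
destruct (hsm 1%nat) as [eps0 [he0 [_ [h1 [h2 [hD _]]]]]].
exists eps0; split; [exact he0 |].
intros eps heps; split.
- destruct (hD 0 eps) as [hd _]; [lra |].
  intros e he; destruct (cont_deriv _ _ _ _ hd e he) as [d [hd0 hnear]].
  exists d; split; [exact hd0 |].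
  intros x [hx hdist]; apply hnear; split; [split; lra | exact hdist].
- exists (fun t => h1 t eps); intros theta hth.
  destruct (hD theta eps) as [hd _]; [lra |].
  apply is_derive_Reals; intros e he.
  destruct (hd e he) as [d [hd0 hnear]].
  (* Increments below this radius keep [theta + t] in the domain of the relative derivative. *)
  assert (hd1 : 0 < Rmin d (Rmin theta (1 - kappa - theta)))
    by (repeat apply Rmin_glb_lt; lra).
  exists (mkposreal _ hd1); intros t ht htd; simpl in htd.
  assert (Rmin d (Rmin theta (1 - kappa - theta)) <= d) by apply Rmin_l.
  assert (Rmin d (Rmin theta (1 - kappa - theta)) <= Rmin theta (1 - kappa - theta))
    by apply Rmin_r.
  assert (Rmin theta (1 - kappa - theta) <= theta) by apply Rmin_l.
  assert (Rmin theta (1 - kappa - theta) <= 1 - kappa - theta) by apply Rmin_r.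
  assert (hta : Rabs t < d) by lra.
  assert (htb : Rabs t < theta) by lra.
  assert (htc : Rabs t < 1 - kappa - theta) by lra.
  apply Rabs_def2 in htb; apply Rabs_def2 in htc.
  specialize (hnear (theta + t)); simpl in hnear; unfold Rdist in hnear.
  replace (theta + t - theta) with t in hnear by ring.
  apply hnear; repeat split; lra.
Qed.

(** Differentiate [eta z = g (theta z)] at [z = 0]: the chain rule gives [g * g'], because
    [theta' = eta = g] there, and the second equation of the system gives the other side. *)
Lemma invariance_equation (c kappa eps : R) (g dg : R -> R) (theta : R) :
  locally_invariant c kappa eps g -> 0 < theta < 1 - kappa ->
  is_derive g theta (dg theta) ->
  g theta * dg theta = c * g theta - forcing eps theta.
Proof.
intros hinv hth hg.
destruct (hinv theta hth) as (d & th & et & hd & hth0 & het0 & hsol).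
destruct (hsol 0) as [[hdth hdet] _]; [rewrite Rabs_R0; exact hd |].
rewrite hth0, het0 in *.
assert (hcomp : is_derive (fun z => g (th z)) 0 (g theta * dg theta)).
{ apply (is_derive_comp g th 0 (dg theta) (g theta)); [rewrite hth0 |]; assumption. }
assert (hdet' : is_derive et 0 (g theta * dg theta)).
{ apply is_derive_ext_loc with (2 := hcomp).
  exists (mkposreal d hd); intros z hz.
  symmetry; apply hsol.
  change (Rabs (z - 0) < d) in hz; rewrite Rminus_0_r in hz; exact hz. }
rewrite <- (is_derive_unique _ _ _ hdet'), (is_derive_unique _ _ _ hdet).
reflexivity.
Qed.

Lemma forcing_pos (eps theta : R) : 0 < eps -> 0 < theta < 1 -> 0 < forcing eps theta.
Proof.
intros he ht; unfold forcing.
apply Rmult_lt_0_compat; [| apply exp_pos].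
apply Rmult_lt_0_compat; [| nra].
apply Rinv_0_lt_compat; nra.
Qed.

(** * A priori positivity and smallness of the invariant graph *)

(** A zero of [g] would give [0 = - f x], so [g] keeps its sign. If it were negative, then
    [g' = c - f / g >= c], and [g] would rise by at least [c * (b - b0) > 2 * m], against
    [Rabs (g x) <= m]. *)
Lemma invariant_graph_pos (c b0 b m : R) (g dg f : R -> R) :
  0 < c -> b0 < b ->
  (forall x, 0 < x <= b -> is_derive g x (dg x)) ->
  (forall x, 0 < x <= b -> g x * dg x = c * g x - f x) ->
  (forall x, 0 < x <= b -> 0 < f x) ->
  (forall x, 0 < x <= b -> Rabs (g x) <= m) ->
  2 * m < c * (b - b0) ->
  forall x, 0 < x <= b0 -> 0 < g x.
Proof.
intros hc hb hd heq hf hm hsmall x0 hx0.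
assert (hcont : forall x, 0 < x <= b -> continuity_pt g x).
{ intros x hx; apply derivable_continuous_pt; exists (dg x).
  apply is_derive_Reals, hd, hx. }
assert (hne : forall x, 0 < x <= b -> g x <> 0).
{ intros x hx h; specialize (heq x hx); specialize (hf x hx).
  rewrite h in heq; lra. }
destruct (Rle_or_lt (g x0) 0) as [hle | hlt]; [exfalso | exact hlt].
assert (hneg : forall x, x0 <= x <= b -> g x < 0).
{ intros x hx; destruct (Rle_or_lt 0 (g x)) as [h | h]; [exfalso | exact h].
  assert (h0 := hne x0 ltac:(lra)); assert (h1 := hne x ltac:(lra)).
  destruct (Req_dec x0 x) as [e | e]; [subst x; lra |].
  destruct (IVT_interv g x0 x) as [z [hz hz0]]; try lra.
  - intros y hy; apply hcont; lra.
  - apply (hne z); lra. }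
destruct (MVT_gen g x0 b dg) as [y [hy hmvt]];
  rewrite ?Rmin_left, ?Rmax_right in * by lra.
- intros y hy; apply hd; lra.
- intros y hy; apply hcont; lra.
- assert (hgy := hneg y hy).
  assert (hey := heq y ltac:(lra)); assert (hfy := hf y ltac:(lra)).
  assert (c <= dg y) by nra.
  assert (c * (b - b0) <= dg y * (b - x0)) by (apply Rmult_le_compat; lra).
  assert (h1 := proj1 (Rabs_le_between _ _) (hm x0 ltac:(lra))).
  assert (h2 := proj1 (Rabs_le_between _ _) (hm b ltac:(lra))).
  lra.
Qed.

(** Where [g >= A], the forcing is at most [c * g / 2], so [g' >= c / 2]. A graph above [A] at [x0]
    would therefore exceed [c / 2 * (b - b0) > m] at [b]. *)
Lemma invariant_graph_le (c b0 b m A : R) (g dg f : R -> R) :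
  0 < c -> b0 < b -> 0 < A ->
  (forall x, 0 < x <= b -> is_derive g x (dg x)) ->
  (forall x, 0 < x <= b -> g x * dg x = c * g x - f x) ->
  (forall x, 0 < x <= b -> 2 * f x <= c * A) ->
  g b <= m ->
  2 * m < c * (b - b0) ->
  forall x, 0 < x <= b0 -> g x <= A.
Proof.
intros hc hb hA hd heq hf hm hsmall x0 hx0.
destruct (Rle_or_lt (g x0) A) as [hle | hlt]; [exact hle | exfalso].
assert (h := ge_start_of_nondecreasing_above
  (fun x => g x - c / 2 * (x - x0)) (fun x => dg x - c / 2) x0 b A).
simpl in h; rewrite Rminus_diag, Rmult_0_r, Rminus_0_r in h.
assert (g x0 <= g b - c / 2 * (b - x0)); [apply h | nra]; clear h.
- lra.
- intros x hx; assert (hgx := hd x ltac:(lra)).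
  auto_derive; [repeat split; exists (dg x); exact hgx |].
  change (Derive (fun t => g t) x) with (Derive g x).
  rewrite (is_derive_unique _ _ _ hgx); field.
- intros x hx h.
  assert (hex := heq x ltac:(lra)); assert (hfx := hf x ltac:(lra)).
  (* The tilted function [g x - c / 2 * (x - x0)] lies below [g] to the right of [x0]. *)
  assert (A <= g x) by nra.
  assert (c / 2 * g x <= g x * dg x) by nra.
  assert (c / 2 <= dg x); [| lra].
  apply Rmult_le_reg_l with (g x); lra.
- exact hlt.
Qed.

(** * The coefficients of the expansion *)

(** The coefficients are polynomials in [theta] and [eps], kept as syntax: the class is closed under
    both partial derivatives and under the recursion, so smoothness follows by induction on the
    order and bounds on the unit square by structural induction. *)
Inductive poly2 : Type :=
  | Cst (a : R) | Theta | Eps | Add (p q : poly2) | Mul (p q : poly2).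

Fixpoint eval (p : poly2) (theta eps : R) : R :=
  match p with
  | Cst a => a
  | Theta => theta
  | Eps => eps
  | Add p q => eval p theta eps + eval q theta eps
  | Mul p q => eval p theta eps * eval q theta eps
  end.

Fixpoint dtheta (p : poly2) : poly2 :=
  match p with
  | Cst _ | Eps => Cst 0
  | Theta => Cst 1
  | Add p q => Add (dtheta p) (dtheta q)
  | Mul p q => Add (Mul (dtheta p) q) (Mul p (dtheta q))
  end.

Fixpoint deps (p : poly2) : poly2 :=
  match p with
  | Cst _ | Theta => Cst 0
  | Eps => Cst 1
  | Add p q => Add (deps p) (deps q)
  | Mul p q => Add (Mul (deps p) q) (Mul p (deps q))
  end.

Lemma is_derive_eval_theta (p : poly2) (theta eps : R) :
  is_derive (fun t => eval p t eps) theta (eval (dtheta p) theta eps).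
Proof.
induction p as [a | | | p hp q hq | p hp q hq]; simpl.
- apply (is_derive_const a).
- apply (is_derive_id theta).
- apply (is_derive_const eps).
- apply (is_derive_plus _ _ _ _ _ hp hq).
- apply (is_derive_mult _ _ _ _ _ hp hq Rmult_comm).
Qed.

Lemma is_derive_eval_eps (p : poly2) (theta eps : R) :
  is_derive (fun t => eval p theta t) eps (eval (deps p) theta eps).
Proof.
induction p as [a | | | p hp q hq | p hp q hq]; simpl.
- apply (is_derive_const a).
- apply (is_derive_const theta).
- apply (is_derive_id eps).
- apply (is_derive_plus _ _ _ _ _ hp hq).
- apply (is_derive_mult _ _ _ _ _ hp hq Rmult_comm).
Qed.

Lemma continuous_eval (p : poly2) (x : R * R) :
  continuous (fun x : R * R => eval p (fst x) (snd x)) x.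
Proof.
induction p as [a | | | p hp q hq | p hp q hq]; simpl.
- apply continuous_const.
- apply continuous_fst.
- apply continuous_snd.
- apply (continuous_plus _ _ _ hp hq).
- apply (continuous_mult _ _ _ hp hq).
Qed.

Lemma derivable_pt_lim_D_in (f df : R -> R) (D : R -> Prop) (x : R) :
  derivable_pt_lim f x (df x) -> D_in f df D x.
Proof.
intros h e he; destruct (h e he) as [d hd].
exists d; split; [apply cond_pos |].
intros y [[_ hne] hy]; simpl in *; unfold Rdist in *.
specialize (hd (y - x)).
replace (x + (y - x)) with y in hd by ring.
apply hd; [lra | exact hy].
Qed.

Lemma Cn_eval (N : nat) (D : R -> R -> Prop) (p : poly2) : Cn N D (eval p).
Proof.
revert p; induction N as [| N IH]; intros p; split.
- intros x _; apply filterlim_filter_le_1 with (2 := continuous_eval p x).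
  intros P; apply filter_le_within.
- exact I.
- intros x _; apply filterlim_filter_le_1 with (2 := continuous_eval p x).
  intros P; apply filter_le_within.
- exists (eval (dtheta p)), (eval (deps p)); split; [| split; apply IH].
  intros x y _; split.
  + apply (derivable_pt_lim_D_in (fun t => eval p t y) (fun t => eval (dtheta p) t y)).
    apply is_derive_Reals, is_derive_eval_theta.
  + apply (derivable_pt_lim_D_in (eval p x) (eval (deps p) x)).
    apply is_derive_Reals, is_derive_eval_eps.
Qed.

Lemma eval_bounded (p : poly2) :
  exists C : R, forall theta eps, 0 <= theta <= 1 -> 0 <= eps <= 1 ->
    Rabs (eval p theta eps) <= C.
Proof.
induction p as [a | | | p [C hp] q [D hq] | p [C hp] q [D hq]]; simpl.
- exists (Rabs a); intros; lra.
- exists 1; intros; apply Rabs_le; lra.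
- exists 1; intros; apply Rabs_le; lra.
- exists (C + D); intros t e ht he.
  eapply Rle_trans; [apply Rabs_triang |].
  apply Rplus_le_compat; auto.
- exists (C * D); intros t e ht he.
  rewrite Rabs_mult; apply Rmult_le_compat; auto using Rabs_pos.
Qed.

Fixpoint sum_poly2 (p : nat -> poly2) (n : nat) : poly2 :=
  match n with
  | O => Cst 0
  | S m => Add (sum_poly2 p m) (p (S m))
  end.

Lemma eval_sum_poly2 (p : nat -> poly2) (n : nat) (theta eps : R) :
  eval (sum_poly2 p n) theta eps = sum_n_m (fun k => eval (p k) theta eps) 1 n.
Proof.
induction n as [| n IH]; simpl.
- symmetry; apply (sum_n_m_zero (G := R_AbelianMonoid)); lia.
- rewrite IH, sum_n_Sm by lia; reflexivity.
Qed.

(** If [x' = x / eps], this is the coefficient of [x ^ j] in the derivative of [eps * p * x ^ j]. *)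
Definition shifted_derivative (j : nat) (p : poly2) : poly2 :=
  Add (Mul Eps (dtheta p)) (Mul (Cst (INR j)) p).

(* A table, because the recursion for F_n refers to all of F_1, ..., F_(n-1); the
   entry F_0 = 0 makes the recursion a Cauchy product. *)
Fixpoint coeffs (c : R) (n : nat) : nat -> poly2 :=
  match n with
  | O => fun _ => Cst 0
  | S m => fun k =>
      if Nat.leb k m then coeffs c m k
      else match m with
           | O => Mul (Cst (/ c)) (Mul Theta (Add (Cst 1) (Mul (Cst (-1)) Theta)))
           | S _ => Mul (Cst (/ c))
               (sum_poly2 (fun j => Mul (shifted_derivative j (coeffs c m j))
                                        (coeffs c m (S m - j))) m)
           end
  end.

Definition coeff (c : R) (k : nat) : poly2 := coeffs c k k.

Lemma coeffs_coeff (c : R) (n k : nat) : (k <= n)%nat -> coeffs c n k = coeff c k.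
Proof.
induction n as [| n IH]; intros hk.
- replace k with 0%nat by lia; reflexivity.
- destruct (Nat.eq_dec k (S n)) as [-> | hne]; [reflexivity |].
  simpl; rewrite (proj2 (Nat.leb_le k n)) by lia; apply IH; lia.
Qed.

Lemma eval_coeff_1 (c theta eps : R) :
  eval (coeff c 1) theta eps = / c * (theta * (1 - theta)).
Proof. simpl; ring. Qed.

Lemma eval_coeff_rec (c : R) (k : nat) (theta eps : R) : c <> 0 -> (2 <= k)%nat ->
  c * eval (coeff c k) theta eps =
  sum_n_m (fun j => eval (shifted_derivative j (coeff c j)) theta eps
                    * eval (coeff c (k - j)) theta eps) 1 (k - 1).
Proof.
intros hc hk.
destruct k as [| [| n]]; [lia | lia |].
assert (hk1 : coeff c (S (S n)) = Mul (Cst (/ c))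
  (sum_poly2 (fun j => Mul (shifted_derivative j (coeffs c (S n) j))
                           (coeffs c (S n) (S (S n) - j))) (S n))).
{ unfold coeff; cbn [coeffs].
  rewrite (proj2 (Nat.leb_gt (S (S n)) (S n))) by lia; reflexivity. }
rewrite hk1; cbn [eval].
rewrite eval_sum_poly2, <- Rmult_assoc, Rinv_r, Rmult_1_l by exact hc.
replace (S (S n) - 1)%nat with (S n) by lia.
apply sum_n_m_ext_loc; intros j hj; cbn [eval].
rewrite (coeffs_coeff c (S n) j), (coeffs_coeff c (S n) (S (S n) - j)) by lia.
reflexivity.
Qed.
(** * The truncated series *)

(** The variable [x] in whose powers the series is expanded; its factor 1/2 absorbs the weights
    [/ 2 ^ k]. *)
Definition layer (theta eps : R) : R :=
  / (2 * eps ^ 3) * exp (- (/ eps * (1 - theta))).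

Lemma layer_pos (theta eps : R) : 0 < eps -> 0 < layer theta eps.
Proof.
intros he; apply Rmult_lt_0_compat; [| apply exp_pos].
apply Rinv_0_lt_compat; assert (h := pow_lt eps 3 he); lra.
Qed.

Lemma layer_shift (a x eps : R) :
  layer x eps = layer a eps * exp (/ eps * (x - a)).
Proof.
unfold layer; rewrite Rmult_assoc, <- exp_plus; do 2 f_equal; ring.
Qed.

Lemma exp_INR_mult (n : nat) (x : R) : exp (INR n * x) = exp x ^ n.
Proof.
induction n as [| n IH].
- simpl; rewrite Rmult_0_l; apply exp_0.
- rewrite S_INR, Rmult_plus_distr_r, Rmult_1_l, exp_plus, IH; simpl; ring.
Qed.

(** With [x = kappa / (4 * eps)], the exponential is at most [exp (- 4 * x) <= / x ^ 4]. The fourth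
    power outdoes [eps ^ 3] by one factor, leaving the bound [128 * eps / kappa ^ 4]. *)
Lemma layer_small (kappa eta : R) : 0 < kappa -> 0 < eta ->
  exists eps0 : R, 0 < eps0 /\ forall theta eps : R,
    0 < eps < eps0 -> theta <= 1 - kappa -> layer theta eps <= eta.
Proof.
intros hk heta.
assert (hk4 := pow_lt kappa 4 hk).
exists (eta * kappa ^ 4 / 128); split; [nra |].
intros t e he ht.
set (x := / e * kappa / 4).
assert (hie : 0 < / e) by (apply Rinv_0_lt_compat; lra).
assert (hx : 0 < x) by (unfold x; nra).
assert (hexp : exp (- (/ e * (1 - t))) <= / x ^ 4).
{ apply Rle_trans with (exp (- (INR 4 * x))).
  - assert (h : - (/ e * (1 - t)) <= - (INR 4 * x)).
    { replace (INR 4 * x) with (/ e * kappa) by (unfold x; simpl; field; lra).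
      apply Ropp_le_contravar, Rmult_le_compat_l; lra. }
    destruct h as [h | h]; [left; apply exp_increasing, h | rewrite h; lra].
  - rewrite exp_Ropp, exp_INR_mult.
    apply Rinv_le_contravar; [apply pow_lt, hx |].
    apply pow_incr; assert (h := exp_ineq1_le x); lra. }
assert (he3 : 0 < / (2 * e ^ 3)).
{ apply Rinv_0_lt_compat; assert (h := pow_lt e 3 (proj1 he)); lra. }
apply Rle_trans with (/ (2 * e ^ 3) * / x ^ 4).
- apply Rmult_le_compat_l; lra.
- replace (/ (2 * e ^ 3) * / x ^ 4) with (e * (128 / kappa ^ 4))
    by (unfold x; field; split; lra).
  apply Rmult_le_reg_r with (kappa ^ 4 / 128); [lra |].
  rewrite Rmult_assoc.
  replace (128 / kappa ^ 4 * (kappa ^ 4 / 128)) with 1 by (field; lra).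
  lra.
Qed.

Lemma gauge_layer (k : nat) (theta eps : R) : 0 < eps ->
  gauge k theta eps = eps * (2 * layer theta eps) ^ k.
Proof.
intros he; induction k as [| k IH].
- unfold gauge; simpl; rewrite !Rmult_0_l, Ropp_0, exp_0; ring.
- set (x := 2 * layer theta eps) in *.
  replace (eps * x ^ S k) with (x * (eps * x ^ k)) by (simpl; ring).
  rewrite <- IH; unfold x.
  unfold gauge, layer.
  replace (-3 * Z.of_nat (S k) + 1)%Z with (-3 + (-3 * Z.of_nat k + 1))%Z by lia.
  rewrite powerRZ_add, S_INR by lra.
  replace (- ((INR k + 1) * / eps * (1 - theta)))
    with (- (/ eps * (1 - theta)) + - (INR k * / eps * (1 - theta))) by ring.
  rewrite exp_plus; change (powerRZ eps (-3)) with (/ eps ^ 3); field; lra.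
Qed.

Lemma forcing_layer (theta eps : R) : 0 < eps ->
  forcing eps theta = eps * layer theta eps * (theta * (1 - theta)).
Proof. intros he; unfold forcing, layer; field; lra. Qed.

Lemma is_derive_layer (theta eps : R) : 0 < eps ->
  is_derive (fun t => layer t eps) theta (/ eps * layer theta eps).
Proof.
intros he; unfold layer, Rminus; auto_derive; [exact I | field; lra].
Qed.

Lemma sum_f_R0_abs_le (x : nat -> R) (n : nat) (M : R) :
  (forall k, (k <= n)%nat -> Rabs (x k) <= M) ->
  Rabs (sum_f_R0 x n) <= INR (S n) * M.
Proof.
intros h; induction n as [| n IH].
- simpl; rewrite Rmult_1_l; apply h; lia.
- rewrite S_INR; simpl sum_f_R0.
  eapply Rle_trans; [apply Rabs_triang |].
  assert (h1 : Rabs (sum_f_R0 x n) <= INR (S n) * M) by (apply IH; intros; apply h; lia).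
  assert (h2 := h (S n) (le_n _)); lra.
Qed.

Definition dcoeff (c : R) (k : nat) : poly2 := shifted_derivative k (coeff c k).

(** The truncation divided by [eps]. The term of index 0 vanishes; it is included so that products
    of such sums are Cauchy products. *)
Definition series_sum (c : R) (K : nat) (theta eps : R) : R :=
  sum_f_R0 (fun k => eval (coeff c k) theta eps * layer theta eps ^ k) K.

(** The [theta]-derivative of [eps * series_sum], not of [series_sum]: the factor [eps] cancels the
    [/ eps] produced by the layer. *)
Definition dseries_sum (c : R) (K : nat) (theta eps : R) : R :=
  sum_f_R0 (fun k => eval (dcoeff c k) theta eps * layer theta eps ^ k) K.

Lemma truncation_series_sum (c : R) (K : nat) (theta eps : R) : 0 < eps ->
  truncation (fun k => eval (coeff c k)) K theta eps = eps * series_sum c K theta eps.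
Proof.
intros he; unfold truncation, series_sum; induction K as [| K IH].
- simpl; rewrite sum_n_m_zero by lia; change zero with 0; ring.
- rewrite sum_n_Sm, IH by lia; rewrite tech5; change plus with Rplus; cbv beta.
  rewrite gauge_layer, Rpow_mult_distr by exact he.
  field; apply pow_nonzero; lra.
Qed.

Lemma is_derive_series_sum (c : R) (K : nat) (theta eps : R) : 0 < eps ->
  is_derive (fun t => eps * series_sum c K t eps) theta (dseries_sum c K theta eps).
Proof.
intros he; unfold series_sum, dseries_sum.
assert (hterm : forall k,
  is_derive (fun t => eps * (eval (coeff c k) t eps * layer t eps ^ k)) theta
    (eval (dcoeff c k) theta eps * layer theta eps ^ k)).
{ intros k.
  assert (h1 := is_derive_eval_theta (coeff c k) theta eps).
  assert (h2 := is_derive_layer theta eps he).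
  assert (h3 := is_derive_mult _ _ _ _ _ h1 (is_derive_pow _ k _ _ h2) Rmult_comm).
  assert (h4 := is_derive_scal _ _ eps _ h3).
  replace (eval (dcoeff c k) theta eps * layer theta eps ^ k)
    with (eps * (eval (dtheta (coeff c k)) theta eps * layer theta eps ^ k
                 + eval (coeff c k) theta eps
                   * (INR k * (/ eps * layer theta eps) * layer theta eps ^ pred k)));
    [exact h4 |].
  unfold dcoeff, shifted_derivative; cbn [eval].
  (* For [k = 0] the exponent [pred k] is 0 again, and the factor [INR 0] removes the term. *)
  destruct k as [| k]; [simpl INR | simpl pred; simpl pow]; field; lra. }
induction K as [| K IH]; [apply hterm |].
simpl sum_f_R0.
eapply is_derive_ext; [| apply (is_derive_plus _ _ _ _ _ IH (hterm (S K)))].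
intros t; change plus with Rplus; simpl; ring.
Qed.

(** The end terms vanish because [F_0 = 0], and for [k >= 2] the others form the recursion. At
    [k = 1] nothing is left, although [c * F_1] is not zero: this defect will match the forcing. *)
Lemma coeff_convolution (c : R) (k : nat) (theta eps : R) : c <> 0 ->
  sum_f_R0 (fun p => eval (dcoeff c p) theta eps * eval (coeff c (k - p)) theta eps) k =
  if Nat.eqb k 1 then 0 else c * eval (coeff c k) theta eps.
Proof.
intros hc.
destruct (le_lt_dec 2 k) as [hk | hk].
- rewrite (proj2 (Nat.eqb_neq k 1)), eval_coeff_rec by (assumption || lia).
  rewrite <- sum_n_Reals; unfold sum_n; rewrite sum_Sn_m by lia.
  destruct k as [| k]; [lia |].
  rewrite sum_n_Sm by lia; rewrite Nat.sub_diag, Nat.sub_0_r.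
  replace (S k - 1)%nat with k by lia.
  change plus with Rplus; unfold dcoeff at 1 3; cbn; ring.
- destruct k as [| [| k]]; [| | lia]; cbn; ring.
Qed.

(** * Residual of the truncated series in the invariance equation *)

(** The product of the two sums splits into complete convolutions up to degree [K] and a remainder
    of higher degree. The former add up to [c * series_sum] without its term [c * F_1 * x], which is
    [forcing / eps]; so only the remainder survives. *)
Lemma residual_remainder (c : R) (K : nat) (theta eps : R) :
  c <> 0 -> (1 <= K)%nat -> 0 < eps ->
  let x := layer theta eps in
  eps * series_sum c K theta eps * dseries_sum c K theta eps
  - c * (eps * series_sum c K theta eps) + forcing eps theta =
  eps * sum_f_R0 (fun k => sum_f_R0 (fun l =>
     (eval (dcoeff c (S (l + k))) theta eps * x ^ S (l + k)) *
     (eval (coeff c (K - l)) theta eps * x ^ (K - l))) (pred (K - k))) (pred K).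
Proof.
intros hc hK he x.
assert (h := cauchy_finite (fun k => eval (dcoeff c k) theta eps * x ^ k)
  (fun k => eval (coeff c k) theta eps * x ^ k) K ltac:(lia)).
match type of h with _ = ?u + ?v => set (U := u) in h; set (V := v) in h end.
change (dseries_sum c K theta eps * series_sum c K theta eps = U + V) in h.
assert (hU : U = c * series_sum c K theta eps - x * (theta * (1 - theta))).
{ unfold U.
  rewrite sum_eq with (Bn := fun k =>
    (if Nat.eqb k 1 then 0 else c * eval (coeff c k) theta eps) * x ^ k).
  2:{ intros k _; rewrite <- coeff_convolution by exact hc.
      rewrite Rmult_comm, scal_sum; apply sum_eq; intros p hp.
      replace (x ^ k) with (x ^ p * x ^ (k - p)) by (rewrite <- pow_add; f_equal; lia).
      ring. }
  unfold series_sum; clear h U V; destruct K as [| K]; [lia |].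
  induction K as [| K IH].
  - cbn; fold x; field; exact hc.
  - rewrite tech5, IH, (tech5 _ (S K)) by lia; cbv beta.
    change (Nat.eqb (S (S K)) 1) with false; cbv iota; fold x; ring. }
fold V; change (eps * series_sum c K theta eps * dseries_sum c K theta eps
  - c * (eps * series_sum c K theta eps) + forcing eps theta = eps * V).
rewrite forcing_layer by exact he; fold x.
replace (eps * series_sum c K theta eps * dseries_sum c K theta eps)
  with (eps * (dseries_sum c K theta eps * series_sum c K theta eps)) by ring.
rewrite h, hU; ring.
Qed.

Lemma coeff_bounded (c : R) (K : nat) :
  exists C : R, 0 < C /\ forall k theta eps,
    (k <= K)%nat -> 0 <= theta <= 1 -> 0 <= eps <= 1 ->
    Rabs (eval (coeff c k) theta eps) <= C /\ Rabs (eval (dcoeff c k) theta eps) <= C.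
Proof.
assert (hone : forall k, exists C : R, 0 < C /\ forall theta eps,
    0 <= theta <= 1 -> 0 <= eps <= 1 ->
    Rabs (eval (coeff c k) theta eps) <= C /\ Rabs (eval (dcoeff c k) theta eps) <= C).
{ intros k; destruct (eval_bounded (coeff c k)) as [C1 h1].
  destruct (eval_bounded (dcoeff c k)) as [C2 h2].
  exists (Rmax 1 (Rmax C1 C2)); split.
  - apply Rlt_le_trans with 1; [lra | apply Rmax_l].
  - intros t e ht he; specialize (h1 t e ht he); specialize (h2 t e ht he).
    assert (h3 := Rmax_r 1 (Rmax C1 C2)).
    assert (h4 := Rmax_l C1 C2); assert (h5 := Rmax_r C1 C2); lra. }
induction K as [| K [C [hC IH]]].
- destruct (hone 0%nat) as [C [hC h]]; exists C; split; [exact hC |].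
  intros k t e hk; replace k with 0%nat by lia; apply h.
- destruct (hone (S K)) as [D [hD h]]; exists (C + D); split; [lra |].
  intros k t e hk ht he; destruct (Nat.eq_dec k (S K)) as [-> | hne].
  + specialize (h t e ht he); lra.
  + specialize (IH k t e ltac:(lia) ht he); lra.
Qed.

(** As [layer <= 1], each power is bounded by the lowest one present: degree 1 in [dseries_sum],
    whose constant term vanishes, and degree [K + 1] in the residual. *)
Lemma truncation_estimates (c : R) (K : nat) : c <> 0 -> (1 <= K)%nat ->
  exists C : R, 0 < C /\ forall theta eps,
    0 <= theta <= 1 -> 0 < eps <= 1 -> layer theta eps <= 1 ->
    Rabs (eps * series_sum c K theta eps) <= C * eps /\
    Rabs (dseries_sum c K theta eps) <= C * layer theta eps /\
    Rabs (eps * series_sum c K theta eps * dseries_sum c K theta eps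
          - c * (eps * series_sum c K theta eps) + forcing eps theta)
      <= C * (eps * layer theta eps ^ S K).
Proof.
intros hc hK; destruct (coeff_bounded c K) as [C [hC hb]].
assert (hK0 : 1 <= INR K) by (apply (le_INR 1), hK).
(* The first summand serves the sums of [K + 1] terms, the second the at most [K * K] products in
   the remainder. *)
exists (INR (S K) * C + INR K * (INR K * (C * C))); split.
{ rewrite S_INR; assert (0 < (INR K + 1) * C) by nra.
  assert (0 < INR K * (INR K * (C * C))) by (repeat apply Rmult_lt_0_compat; lra); lra. }
intros t e ht he hx1.
assert (hx0 := layer_pos t e (proj1 he)).
assert (hpow : forall n, 0 <= layer t e ^ n <= 1).
{ intros n; split; [apply pow_le; lra |].
  rewrite <- (pow1 n); apply pow_incr; lra. }
assert (hC1 : 0 <= INR (S K) * C) by (apply Rmult_le_pos; [apply pos_INR | lra]).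
assert (hC2 : 0 <= INR K * (INR K * (C * C))) by (repeat apply Rmult_le_pos; lra).
split; [| split].
- rewrite Rabs_mult, (Rabs_right e), Rmult_comm by lra.
  apply Rmult_le_compat_r; [lra |].
  apply Rle_trans with (INR (S K) * C); [| lra].
  apply sum_f_R0_abs_le; intros k hk.
  rewrite Rabs_mult, (Rabs_right (_ ^ k)) by (apply Rle_ge, hpow).
  destruct (hb k t e hk ht ltac:(lra)) as [h _].
  rewrite <- (Rmult_1_r C); apply Rmult_le_compat; try apply Rabs_pos; try apply hpow; exact h.
- apply Rle_trans with (INR (S K) * (C * layer t e)).
  2:{ rewrite <- Rmult_assoc; apply Rmult_le_compat_r; lra. }
  apply sum_f_R0_abs_le; intros k hk.
  destruct k as [| k].
  + replace (eval (dcoeff c 0) t e) with 0 by (cbn; ring).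
    rewrite Rmult_0_l, Rabs_R0; nra.
  + rewrite Rabs_mult, (Rabs_right (_ ^ S k)) by (apply Rle_ge, hpow).
    destruct (hb (S k) t e hk ht ltac:(lra)) as [_ h].
    apply Rmult_le_compat; [apply Rabs_pos | apply hpow | exact h |].
    simpl; destruct (hpow k); nra.
- rewrite residual_remainder by (assumption || lra).
  rewrite Rabs_mult, (Rabs_right e) by lra.
  rewrite <- Rmult_assoc, (Rmult_comm _ e), Rmult_assoc.
  apply Rmult_le_compat_l; [lra |].
  apply Rle_trans with (INR K * (INR K * (C * C * layer t e ^ S K))).
  2:{ destruct (hpow (S K)); nra. }
  assert (hCx : 0 <= C * C * layer t e ^ S K)
    by (apply Rmult_le_pos; [nra | apply hpow]).
  replace (INR K) with (INR (S (pred K))) at 1 by (f_equal; lia).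
  apply sum_f_R0_abs_le; intros k hk.
  apply Rle_trans with (INR (S (pred (K - k))) * (C * C * layer t e ^ S K)).
  2:{ apply Rmult_le_compat_r; [exact hCx | apply le_INR; lia]. }
  apply sum_f_R0_abs_le; intros l hl.
  destruct (hb (S (l + k)) t e ltac:(lia) ht ltac:(lra)) as [_ h1].
  destruct (hb (K - l)%nat t e ltac:(lia) ht ltac:(lra)) as [h2 _].
  match goal with |- Rabs (?d * ?u * (?a * ?v)) <= _ =>
    replace (d * u * (a * v)) with (d * a * (u * v)) by ring end.
  rewrite <- pow_add.
  (* Each product has degree [K + 1 + k], and the extra [k] powers are at most 1. *)
  replace (S (l + k) + (K - l))%nat with (S K + k)%nat by lia.
  rewrite pow_add, !Rabs_mult, !(Rabs_right (_ ^ _)) by (apply Rle_ge, hpow).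
  apply Rmult_le_compat.
  + apply Rmult_le_pos; apply Rabs_pos.
  + apply Rmult_le_pos; apply hpow.
  + apply Rmult_le_compat; auto using Rabs_pos.
  + destruct (hpow (S K)), (hpow k); nra.
Qed.

(** * Comparison of the slow manifold with the truncated series *)

Lemma le_at_left_end (f k : R -> R) (b d : R) :
  0 < b <= d -> limit1_in f (fun t => 0 < t < d) (f 0) 0 -> continuity_pt k 0 ->
  (forall t, 0 < t < b -> f t <= k t) -> f 0 <= k 0.
Proof.
intros hb hf hk hle.
destruct (Rle_or_lt (f 0) (k 0)) as [h | h]; [exact h | exfalso].
destruct (hf ((f 0 - k 0) / 2)) as [d1 [hd1 h1]]; [lra |].
destruct (hk ((f 0 - k 0) / 2)) as [d2 [hd2 h2]]; [lra |].
set (t := Rmin (b / 2) (Rmin (d1 / 2) (d2 / 2))).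
assert (ht : 0 < t) by (repeat apply Rmin_glb_lt; lra).
assert (htb : t <= b / 2) by apply Rmin_l.
assert (ht12 : t <= Rmin (d1 / 2) (d2 / 2)) by apply Rmin_r.
assert (ht1 := Rle_trans _ _ _ ht12 (Rmin_l _ _)).
assert (ht2 := Rle_trans _ _ _ ht12 (Rmin_r _ _)).
specialize (h1 t); specialize (h2 t); specialize (hle t).
simpl in h1, h2; unfold Rdist in h1, h2.
rewrite Rminus_0_r, (Rabs_right t) in h1, h2 by lra.
assert (h3 := Rabs_def2 _ _ (h1 ltac:(lra))).
assert (h4 := Rabs_def2 _ _ (h2 ltac:(repeat split; auto; lra))).
specialize (hle ltac:(lra)); lra.
Qed.

(** The sign [s] treats both bounds on [w = g - T] at once. Only the crude estimate [(m + C) * eps]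
    is known for [w] at [b]; growth at rate [mu] over a length at least [delta] turns it into the
    sharp bound at [a]. *)
Lemma one_sided_truncation_bound (s c eps delta m A B C a b : R) (K : nat)
    (g dg : R -> R) :
  s = 1 \/ s = -1 ->
  0 < c -> 0 < eps <= 1 -> 0 < delta <= 1 -> 0 < a -> a + delta <= b <= 1 ->
  0 < C -> 0 < B -> 4 * C <= c * B -> 2 ^ S K * (m + C) <= B ->
  4 * (INR (S K) / (delta * eps)) * A <= c ->
  (forall x, a <= x <= b -> is_derive g x (dg x)) ->
  (forall x, a <= x <= b -> 0 < g x <= A) ->
  (forall x, a <= x <= b -> g x * dg x = c * g x - forcing eps x) ->
  (forall x, a <= x <= b ->
    Rabs (eps * series_sum c K x eps) <= C * eps /\
    Rabs (dseries_sum c K x eps) <= c / 2 /\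
    Rabs (eps * series_sum c K x eps * dseries_sum c K x eps
          - c * (eps * series_sum c K x eps) + forcing eps x)
      <= C * (eps * layer x eps ^ S K)) ->
  Rabs (g b) <= m * eps ->
  s * (g a - eps * series_sum c K a eps) <= B * (eps * layer a eps ^ S K).
Proof.
intros hs hc he hd ha hb hC hB hBC hBm hA hder hg heq hest hend.
set (T := fun x => eps * series_sum c K x eps) in *.
assert (hn : 1 <= INR (S K)) by (apply (le_INR 1); lia).
assert (hde : 0 < delta * eps) by nra.
(* Chosen so that [mu * delta = (K + 1) / eps], the exponent to be beaten in [layer ^ (K + 1)]. *)
set (mu := INR (S K) / (delta * eps)) in *.
assert (hmu : 0 < mu) by (apply Rdiv_lt_0_compat; lra).
assert (hie : 0 < / eps) by (apply Rinv_0_lt_compat; lra).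
(* The exponential growth rate of [layer ^ (K + 1)] in [x]. *)
set (nu := INR (S K) * / eps).
assert (hnu : 0 <= nu <= mu).
{ split; [apply Rmult_le_pos; lra |].
  unfold nu, mu, Rdiv; apply Rmult_le_compat_l; [lra |].
  apply Rinv_le_contravar; nra. }
assert (hla := layer_pos a eps (proj1 he)).
assert (hgam : 0 < eps * layer a eps ^ S K)
  by (apply Rmult_lt_0_compat; [lra | apply pow_lt, hla]).
apply (repelling_linear_bound c mu nu B C a b _ g
  (fun x => s * (g x - T x)) (fun x => s * (dg x - dseries_sum c K x eps))
  (fun x => dseries_sum c K x eps)
  (fun x => s * (T x * dseries_sum c K x eps - c * T x + forcing eps x)));
  try lra.
- intros x hx; apply (is_derive_scal (fun x => g x - T x)).
  apply (is_derive_minus g T); [apply hder, hx |].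
  apply is_derive_series_sum; lra.
- intros x hx; destruct (hg x hx); split; [lra |].
  apply Rle_trans with (2 := hA); apply Rmult_le_compat_l; lra.
- intros x hx; specialize (heq x hx).
  replace (g x * (s * (dg x - dseries_sum c K x eps)))
    with (s * (g x * dg x - g x * dseries_sum c K x eps)) by ring.
  rewrite heq; ring.
- intros x hx; destruct (hest x hx) as (_ & h & _).
  apply Rabs_le_between in h; lra.
- intros x hx; destruct (hest x hx) as (_ & _ & h).
  rewrite (layer_shift a x), Rpow_mult_distr, <- exp_INR_mult in h.
  unfold nu, T; rewrite (Rmult_assoc (INR (S K))), (Rmult_assoc eps).
  apply Rabs_le_between in h; destruct hs; subst s; lra.
(* Since [eps <= 1] and [a > 0], [layer a eps * exp (/ eps)] is at least 1/2. *)
- assert (hgb : B * (eps / 2 ^ S K) <= B * (eps * layer a eps ^ S K) * exp (mu * (b - a))).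
  { rewrite (Rmult_assoc B), (Rmult_assoc eps).
    apply Rmult_le_compat_l; [lra |]; unfold Rdiv; apply Rmult_le_compat_l; [lra |].
    apply Rle_trans with ((layer a eps * exp (/ eps)) ^ S K).
    - rewrite <- pow_inv; apply pow_incr.
      assert (hhalf : 0 < / 2) by lra; split; [lra |].
      unfold layer; rewrite Rmult_assoc, <- exp_plus.
      rewrite <- (Rmult_1_r (/ 2)); apply Rmult_le_compat; try lra.
      + apply Rinv_le_contravar; [assert (h := pow_lt eps 3 (proj1 he)); lra |].
        assert (h : eps ^ 3 <= 1) by (rewrite <- (pow1 3); apply pow_incr; lra); lra.
      + apply Rle_trans with (2 := exp_ineq1_le _).
        assert (0 <= / eps * a) by (apply Rmult_le_pos; lra); lra.
    - rewrite Rpow_mult_distr; apply Rmult_le_compat_l; [apply pow_le; lra |].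
      rewrite <- exp_INR_mult.
      assert (h : INR (S K) * / eps <= mu * (b - a)).
      { replace (INR (S K) * / eps) with (mu * delta) by (unfold mu; field; lra).
        apply Rmult_le_compat_l; lra. }
      destruct h as [h | h]; [left; apply exp_increasing, h | rewrite h; lra]. }
  apply Rle_trans with (2 := hgb).
  assert (hp := pow_lt 2 (S K) ltac:(lra)).
  assert (hBm' : (m + C) * eps <= B * (eps / 2 ^ S K)).
  { apply Rmult_le_reg_l with (2 ^ S K); [exact hp |].
    replace (2 ^ S K * (B * (eps / 2 ^ S K))) with (B * eps) by (field; lra).
    rewrite <- Rmult_assoc; apply Rmult_le_compat_r; lra. }
  apply Rle_trans with (2 := hBm').
  destruct (hest b ltac:(lra)) as (h & _ & _); unfold T.
  apply Rabs_le_between in h; apply Rabs_le_between in hend.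
  destruct hs; subst s; lra.
Qed.

(** The gap between [1 - kappa] and [1 - kappa'] is cut into thirds of length [delta]. The last
    keeps [b] in the interior, the middle one [[b0, b]] gives positivity and smallness of [g] up to
    [b0], and the first gives the room for the comparison with the series. *)
Lemma slow_manifold_expansion (c kappa kappa' : R) (h : R -> R -> R) (K : nat) :
  0 < c -> 0 < kappa' < kappa -> kappa < 1 -> (1 <= K)%nat ->
  slow_manifold c kappa' h ->
  exists B eps0 : R, 0 < eps0 /\ forall theta eps : R,
    0 <= theta <= 1 - kappa -> 0 < eps < eps0 ->
    Rabs (h theta eps - eps * series_sum c K theta eps)
      <= B * (eps * layer theta eps ^ S K).
Proof.
intros hc hk' hk hK hslow.
destruct (slow_manifold_derivable c kappa' h ltac:(lra) hslow) as [e1 [he1 hder]].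
destruct hslow as (_ & [e2 [he2 hinv]] & [m0 [e3 [he3 hbound]]]).
destruct (truncation_estimates c K ltac:(lra) hK) as [C [hC hest]].
set (delta := (kappa - kappa') / 3).
set (m := Rmax 0 m0).
assert (hm : 0 <= m) by apply Rmax_l.
assert (hm0 : m0 <= m) by apply Rmax_r.
assert (hn : 1 <= INR (S K)) by (apply (le_INR 1); lia).
assert (hdelta : 0 < delta <= 1) by (unfold delta; lra).
assert (hA0 : 0 < c * delta / (4 * INR (S K))) by (apply Rdiv_lt_0_compat; nra).
(* With [A = A0 * eps] and [mu = (K + 1) / (delta * eps)] this gives [4 * mu * A = c]. *)
set (A0 := c * delta / (4 * INR (S K))) in *.
(* The three bounds on the layer serve the truncation estimates, [T' <= c / 2], and a forcing of at
   most [c * A0 * eps / 2]. *)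
assert (hetapos : 0 < Rmin 1 (Rmin (c / (2 * C)) (c * A0 / 2))).
{ repeat apply Rmin_glb_lt; [lra | apply Rdiv_lt_0_compat; lra | nra]. }
destruct (layer_small kappa' _ (proj1 hk') hetapos) as [e4 [he4 hlayer]].
assert (he5 : 0 < c * delta / (2 * (m + 1))) by (apply Rdiv_lt_0_compat; nra).
(* Below [e5] the a priori bound satisfies [2 * m * eps < c * delta]. *)
set (e5 := c * delta / (2 * (m + 1))) in *.
(* One summand for each lower bound required of [B] in the comparison. *)
set (B := 4 * C / c + 2 ^ S K * (m + C)).
assert (hp := pow_lt 2 (S K) ltac:(lra)).
assert (hCc : 0 < 4 * C / c) by (apply Rdiv_lt_0_compat; lra).
assert (hmC : 0 < 2 ^ S K * (m + C)) by (apply Rmult_lt_0_compat; lra).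
exists B, (Rmin 1 (Rmin e1 (Rmin e2 (Rmin e3 (Rmin e4 e5))))).
split; [repeat apply Rmin_glb_lt; lra |].
intros theta eps htheta heps.
assert (hall : 0 < eps < 1 /\ eps < e1 /\ eps < e2 /\ eps < e3 /\ eps < e4 /\ eps < e5).
{ destruct heps as [h0 heps].
  repeat match goal with
  | H : eps < Rmin ?u ?v |- _ =>
      let H1 := fresh in let H2 := fresh in
      assert (H1 := Rlt_le_trans _ _ _ H (Rmin_l u v));
      assert (H2 := Rlt_le_trans _ _ _ H (Rmin_r u v)); clear H
  end; repeat split; assumption. }
destruct hall as (h01 & h1 & h2 & h3 & h4 & h5); clear heps.
destruct (hder eps ltac:(lra)) as [hlim [dg hdg]]; clear hder.
specialize (hinv eps ltac:(lra)).
set (g := fun t => h t eps) in *.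
set (b := 1 - kappa' - delta); set (b0 := 1 - kappa + delta).
assert (hb : b0 + delta = b) by (unfold b, b0, delta; field).
assert (hb0 : b0 = 1 - kappa + delta) by reflexivity.
assert (hb01 : 0 < b0 /\ b < 1) by (unfold b, b0, delta; lra).
assert (heq : forall x, 0 < x <= b -> g x * dg x = c * g x - forcing eps x).
{ intros x hx; apply (invariance_equation c kappa' eps g dg x hinv);
    [| apply hdg]; unfold b in *; lra. }
assert (hgder : forall x, 0 < x <= b -> is_derive g x (dg x))
  by (intros x hx; apply hdg; unfold b in *; lra).
assert (hgm : forall x, 0 < x <= b -> Rabs (g x) <= m * eps).
{ intros x hx; apply Rle_trans with (m0 * eps);
    [apply hbound; unfold b in *; lra | apply Rmult_le_compat_r; lra]. }
assert (hsmall : 2 * (m * eps) < c * (b - b0)).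
{ replace (b - b0) with delta by lra.
  assert (hem : eps * (2 * (m + 1)) < c * delta); [| nra].
  replace (c * delta) with (e5 * (2 * (m + 1))) by (unfold e5; field; lra).
  apply Rmult_lt_compat_r; lra. }
assert (hlay : forall x, x <= b -> 0 < layer x eps <= 1 /\
  C * layer x eps <= c / 2 /\ layer x eps <= c * A0 / 2).
{ intros x hx; specialize (hlayer x eps ltac:(lra) ltac:(unfold b in *; lra)).
  assert (hl1 := Rle_trans _ _ _ hlayer (Rmin_l _ _)).
  assert (hl := Rle_trans _ _ _ hlayer (Rmin_r _ _)).
  assert (hl2 := Rle_trans _ _ _ hl (Rmin_l _ _)).
  assert (hl3 := Rle_trans _ _ _ hl (Rmin_r _ _)).
  repeat split; [apply layer_pos; lra | exact hl1 | | exact hl3].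
  replace (c / 2) with (C * (c / (2 * C))) by (field; lra).
  apply Rmult_le_compat_l; lra. }
assert (hgpos : forall x, 0 < x <= b0 -> 0 < g x).
{ apply (invariant_graph_pos c b0 b (m * eps) g dg (forcing eps)); try assumption; [lra |].
  intros x hx; apply forcing_pos; [| unfold b in *]; lra. }
assert (hgA : forall x, 0 < x <= b0 -> g x <= A0 * eps).
{ apply (invariant_graph_le c b0 b (m * eps) (A0 * eps) g dg (forcing eps));
    try assumption; try lra.
  - nra.
  - intros x hx; rewrite forcing_layer by lra.
    destruct (hlay x (proj2 hx)) as [hl0 [_ hl]].
    assert (x * (1 - x) <= 1) by nra.
    assert (layer x eps * (x * (1 - x)) <= c * A0 / 2 * 1).
    { apply Rmult_le_compat; try lra; apply Rmult_le_pos; unfold b in *; lra. }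
    nra.
  - apply Rle_trans with (1 := Rle_abs _), hgm; lra. }
assert (hside : forall s a, s = 1 \/ s = -1 -> 0 < a <= 1 - kappa ->
  s * (g a - eps * series_sum c K a eps) <= B * (eps * layer a eps ^ S K)).
{ intros s a hs ha.
  assert (hKe : INR (S K) <> 0) by lra.
  apply (one_sided_truncation_bound s c eps delta m (A0 * eps) B C a b0 K g dg);
    try assumption; try lra.
  - unfold B; lra.
  - unfold B; replace (c * (4 * C / c + 2 ^ S K * (m + C)))
      with (4 * C + c * (2 ^ S K * (m + C))) by (field; lra).
    assert (0 < c * (2 ^ S K * (m + C))) by (apply Rmult_lt_0_compat; lra); lra.
  - unfold B; lra.
  - right; unfold A0; field; lra.
  - intros x hx; apply hgder; lra.
  - intros x hx; split; [apply hgpos | apply hgA]; lra.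
  - intros x hx; apply heq; lra.
  - intros x hx.
    destruct (hlay x ltac:(lra)) as [hl0 [hl _]].
    destruct (hest x eps ltac:(lra) ltac:(lra) (proj2 hl0)) as (q1 & q2 & q3).
    repeat split; [exact q1 | lra | exact q3].
  - apply hgm; lra. }
assert (hclosed : forall s, s = 1 \/ s = -1 ->
  s * (g theta - eps * series_sum c K theta eps) <= B * (eps * layer theta eps ^ S K)).
{ intros s hs.
  (* The invariance equation is available for [theta > 0] only; the bound passes to 0 in the
     limit. *)
  destruct (Req_dec theta 0) as [-> | hne]; [| apply hside; [exact hs | lra]].
  set (k := fun t => s * (eps * series_sum c K t eps) + B * (eps * layer t eps ^ S K)).
  assert (hle : s * g 0 <= k 0); [| unfold k in hle; lra].
  apply (le_at_left_end (fun t => s * g t) k (1 - kappa) (1 - kappa')).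
  - lra.
  - apply (limit_mul (fun _ => s) g); [| exact hlim].
    intros e he; exists 1; split; [lra |].
    intros x _; simpl; unfold Rdist; rewrite Rminus_diag, Rabs_R0; exact he.
  - apply derivable_continuous_pt; unfold k.
    apply ex_derive_Reals_0.
    assert (q1 := is_derive_series_sum c K 0 eps ltac:(lra)).
    assert (q2 := is_derive_layer 0 eps ltac:(lra)).
    apply (ex_derive_plus (fun t => s * (eps * series_sum c K t eps))).
    + apply ex_derive_scal; eexists; exact q1.
    + do 2 apply ex_derive_scal.
      apply ex_derive_pow; eexists; exact q2.
  - intros t ht; assert (q := hside s t hs ltac:(lra)); unfold k; lra. }
apply Rabs_le_between'; fold (g theta).
assert (q1 := hclosed 1 ltac:(lra)); assert (q2 := hclosed (-1) ltac:(lra)).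
change (h theta eps) with (g theta); lra.
Qed.

Theorem proposition3p3 (c kappa : R) (hc : 0 < c) (hkappa : 0 < kappa < 1) :
  exists F : nat -> R -> R -> R,
    (forall theta eps : R, F 1%nat theta eps = / c * (theta * (1 - theta))) /\
    (forall k : nat, (2 <= k)%nat ->
       smooth2 (F k) /\
       forall theta eps : R,
         c * F k theta eps =
         sum_n_m (fun j : nat =>
           (eps * Derive (fun t => F j t eps) theta
            + INR j * F j theta eps) * F (k - j)%nat theta eps) 1 (k - 1)) /\
    forall h : R -> R -> R, suitable_slow_manifold c kappa h ->
      (forall K : nat, (1 <= K)%nat ->
         bigO_unif kappa
           (fun theta eps => h theta eps - truncation F K theta eps)
           (gauge (K + 1))) /\
      bigO_unif kappa
        (fun theta eps =>
           h theta eps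
           - / (2 * c) * (theta * (1 - theta)) * powerRZ eps (-2)
             * exp (- (/ eps * (1 - theta))))
        (fun theta eps =>
           powerRZ eps (-5) * exp (- (2 * / eps * (1 - theta)))).
Proof.
exists (fun k => eval (coeff c k)); split; [| split].
- apply eval_coeff_1.
- intros k hk; split.
  + intros N; apply Cn_eval.
  + intros theta eps; rewrite eval_coeff_rec by (lra || assumption).
    apply sum_n_m_ext; intros j.
    apply (f_equal (fun d => (eps * d + _) * _)); symmetry.
    apply is_derive_unique, is_derive_eval_theta.
- intros h [_ (kappa' & h' & hk' & hslow & e0 & he0 & hh)].
  assert (hexp : forall K : nat, (1 <= K)%nat ->
    bigO_unif kappa
      (fun theta eps => h theta eps - truncation (fun k => eval (coeff c k)) K theta eps)
      (gauge (K + 1))).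
  { intros K hK.
    (* The estimate is made for the extension [h'], which agrees with [h] on [[0, 1 - kappa]] for
       small [eps]. *)
    destruct (slow_manifold_expansion c kappa kappa' h' K) as (B & e1 & he1 & hB);
      try assumption; try lra.
    (* The division compensates the factor 2 in [gauge (K + 1) = eps * (2 * layer) ^ (K + 1)]. *)
    exists (B / 2 ^ S K), (Rmin e0 e1); split; [apply Rmin_glb_lt; lra |].
    intros theta eps htheta heps.
    assert (q0 := Rmin_l e0 e1); assert (q1 := Rmin_r e0 e1).
    rewrite truncation_series_sum, gauge_layer, <- hh by lra.
    replace (K + 1)%nat with (S K) by lia.
    assert (hl := layer_pos theta eps ltac:(lra)).
    rewrite (Rabs_right (eps * _))
      by (apply Rle_ge, Rmult_le_pos; [lra | apply pow_le; lra]).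
    rewrite Rpow_mult_distr.
    replace (B / 2 ^ S K * (eps * (2 ^ S K * layer theta eps ^ S K)))
      with (B * (eps * layer theta eps ^ S K))
      by (field; apply pow_nonzero; lra).
    apply hB; lra. }
  split; [exact hexp |].
  (* For [K = 1] the truncation is the leading term and [gauge 2] the stated error. *)
  destruct (hexp 1%nat (le_n _)) as (M & e1 & he1 & hM).
  exists M, e1; split; [exact he1 |]; intros theta eps htheta heps.
  specialize (hM theta eps htheta heps).
  assert (hg : gauge (1 + 1) theta eps
    = powerRZ eps (-5) * exp (- (2 * / eps * (1 - theta)))) by reflexivity.
  assert (ht : truncation (fun k => eval (coeff c k)) 1 theta eps
    = / (2 * c) * (theta * (1 - theta)) * powerRZ eps (-2)
      * exp (- (/ eps * (1 - theta)))).
  { unfold truncation; rewrite sum_n_n, eval_coeff_1; unfold gauge.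
    change (INR 1) with 1; rewrite Rmult_1_l, pow_1, Rinv_mult.
    change (-3 * Z.of_nat 1 + 1)%Z with (-2)%Z; ring. }
  rewrite <- hg, <- ht; exact hM.
Qed.
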